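(* There exists an absolute constant $c_{abs}>0$ such that for each $n\in\{2,3\}$ the following holds. There exist a unimodular lattice $\Lambda$ in $\mathbb{R}^n$ that is weakly admissible for $(\mathcal{S},C)$, where $\mathcal{S}=(\boldsymbol{m},\boldsymbol{\beta})$ with $m_i=\beta_i=1$ for $1\le i\le n$ (so $N=n$) and $C=\{(x_1,\ldots,x_n)\in\mathbb{R}^n: x_n=0\}$, and a sequence of aligned boxes $Z_{\boldsymbol{Q}}=[-Q_1,Q_1]\times\cdots\times[-Q_n,Q_n]$, each satisfying $Q_i\le\overline{Q}$ for all $1\le i\le n-1$, that are increasingly distorted (i.e. $\overline{Q}/Q_{max}$ tends to zero along the sequence) and whose volume $(2\overline{Q})^n$ tends to infinity along the sequence, such that for each box $Z_{\boldsymbol{Q}}$ in the sequence $$\left|\#(Z_{\boldsymbol{Q}}\cap\Lambda)-\frac{\mathrm{Vol}\, Z_{\boldsymbol{Q}}}{\det\Lambda}\right|\ge c_{abs}\inf_{0<B\leq Q_{max}}\left(\frac{\overline{Q}}{\mu(\Lambda,B)}+\frac{Q_{max}}{B}\right)^{n-1}.$$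
   Context: A lattice in $\mathbb{R}^n$ always has rank $n$; unimodular means $\det\Lambda=1$. $|\cdot|$ is the Euclidean norm. For $\boldsymbol{Q}=(Q_1,\ldots,Q_n)\in(0,\infty)^n$: $\overline{Q}:=(Q_1\cdots Q_n)^{1/n}$ and $Q_{max}:=\max_iQ_i$. For $\Gamma\subset\mathbb{R}^n$ and $\rho>0$ (with $\mathcal{S}$ and $C$ as in the statement) $\nu(\Gamma,\rho):=\inf\{|x_1\cdots x_n|^{1/n}:\underline{\mathbf{x}}=(x_1,\ldots,x_n)\in\Gamma\setminus C,\ |\underline{\mathbf{x}}|<\rho\}$, $\lambda_1(\Gamma):=\inf\{|\underline{\mathbf{x}}|:\underline{\mathbf{x}}\in\Gamma\setminus\{\mathbf{0}\}\}$, and $\mu(\Gamma,\rho):=\min\{\lambda_1(\Gamma\cap C),\nu(\Gamma,\rho)\}$, with $\inf\emptyset=\infty$ and $1/\infty$ interpreted as $0$. $\Lambda$ is weakly admissible for $(\mathcal{S},C)$ if $\nu(\Lambda,\rho)>0$ for all $\rho>0$. *)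

(* Defs.v *)
From HB Require Import structures.
From mathcomp Require Import all_boot all_order all_algebra finmap.
From mathcomp Require Import all_classical all_reals all_analysis.

Set Implicit Arguments.
Unset Strict Implicit.
Unset Printing Implicit Defensive.

Import Order.TTheory GRing.Theory Num.Theory.
Import numFieldNormedType.Exports.

Local Open Scope classical_set_scope.
Local Open Scope ring_scope.

(* The library norm `|x| on 'rV[R]_n is the sup norm, hence this definition. *)
Definition enorm (R : realType) (n : nat) (x : 'rV[R]_n) : R :=
  Num.sqrt (\sum_(i < n) x 0 i ^+ 2).

Definition is_lattice_basis (R : realType) (n : nat) (L : set 'rV[R]_n)
    (A : 'M[R]_n) : Prop :=
  A \in unitmx /\ L = [set map_mx intr z *m A | z in [set: 'rV[int]_n]].

Definition is_lattice (R : realType) (n : nat) (L : set 'rV[R]_n) : Prop :=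
  exists A : 'M[R]_n, is_lattice_basis L A.

(* [xget] picks some basis of L; the value does not depend on which one, see
   [lattice_detE]. *)
Definition lattice_det (R : realType) (n : nat) (L : set 'rV[R]_n) : R :=
  `|\det (xget 0 [set A | is_lattice_basis L A])|.

Lemma lattice_basis_sub (R : realType) (n : nat) (L : set 'rV[R]_n)
    (A B : 'M[R]_n) :
  is_lattice_basis L A -> is_lattice_basis L B ->
  exists Z : 'M[int]_n, B = map_mx intr Z *m A.
Proof.
move=> [uA LA] [uB LB].
have rowB i : exists z : 'rV[int]_n, map_mx intr z *m A = row i B.
  have : L (row i B).
    rewrite LB; exists (delta_mx 0 i) => //.
    rewrite rowE; congr (_ *m _); apply/matrixP => a b.
    by rewrite !mxE; case: (_ && _).
  by rewrite LA => -[z _ <-]; exists z.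
have [f fE] := choice rowB.
exists (\matrix_(i, j) f i 0 j).
apply/row_matrixP => i; rewrite row_mul -fE; congr (_ *m _).
by apply/rowP => j; rewrite !mxE.
Qed.

Lemma lattice_detE (R : realType) (n : nat) (L : set 'rV[R]_n) (A : 'M[R]_n) :
  is_lattice_basis L A -> lattice_det L = `|\det A|.
Proof.
move=> LA; rewrite /lattice_det; case: xgetP => [B _ LB|/(_ A)//].
have le (C D : 'M[R]_n) : is_lattice_basis L C -> is_lattice_basis L D ->
    `|\det C| <= `|\det D|.
  move=> LC LD; have [Z ZE] := lattice_basis_sub LC LD.
  have : \det D != 0 by rewrite -unitfE -unitmxE; case: LD.
  rewrite ZE det_mulmx mulf_eq0 negb_or => /andP[Z0 C0].
  rewrite normrM ler_peMl//.
  move: Z0; rewrite det_map_mx intr_eq0 => Z0.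
  rewrite -intr_norm ler1z.
  by rewrite -gtz0_ge1 normr_gt0.
by apply/eqP; rewrite eq_le !le.
Qed.

(* The hyperplane x_n = 0; coordinates are numbered from 0. *)
Definition last_coord0 (R : realType) (n : nat) : set 'rV[R]_n :=
  [set x | forall i : 'I_n, i.+1 = n -> x 0 i = 0].

(* Infima are taken in \bar R, so that the infimum over an empty set is +oo. *)

Definition nu (R : realType) (n : nat) (C L : set 'rV[R]_n) (rho : R) : \bar R :=
  ereal_inf [set ((`|\prod_(i < n) x 0 i| `^ n%:R^-1)%:E)%E
            | x in [set x | (L `\` C) x /\ enorm x < rho]].

Definition lambda1 (R : realType) (n : nat) (L : set 'rV[R]_n) : \bar R :=
  ereal_inf [set ((enorm x)%:E)%E | x in L `\ 0].

Definition mu (R : realType) (n : nat) (C L : set 'rV[R]_n) (rho : R) : \bar R :=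
  Order.min (lambda1 (L `&` C)) (nu C L rho).

Definition weakly_admissible (R : realType) (n : nat) (C L : set 'rV[R]_n) :
    Prop :=
  forall rho : R, 0 < rho -> (0 < nu C L rho)%E.

Definition box (R : realType) (n : nat) (Q : 'rV[R]_n) : set 'rV[R]_n :=
  [set x | forall i : 'I_n, - Q 0 i <= x 0 i <= Q 0 i].

Definition box_vol (R : realType) (n : nat) (Q : 'rV[R]_n) : R :=
  \prod_(i < n) (Q 0 i - (- Q 0 i)).

Definition Qbar (R : realType) (n : nat) (Q : 'rV[R]_n) : R :=
  (\prod_(i < n) Q 0 i) `^ n%:R^-1.

(* Only used for positive Q, where the default value 0 is irrelevant. *)
Definition Qmax (R : realType) (n : nat) (Q : 'rV[R]_n) : R :=
  \big[Num.max/0]_(i < n) Q 0 i.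

(* [fset_set] is the empty set on infinite sets; for a lattice, [box Q `&` L]
   is always finite, see [finite_box_lattice]. *)
Definition box_count (R : realType) (n : nat) (L : set 'rV[R]_n)
    (Q : 'rV[R]_n) : nat :=
  #|` fset_set (box Q `&` L)|%fset.

Lemma finite_box_lattice (R : realType) (n : nat) (L : set 'rV[R]_n)
    (Q : 'rV[R]_n) :
  is_lattice L -> finite_set (box Q `&` L).
Proof.
move=> [A [uA ->]].
pose M := \sum_(i < n) \sum_(j < n) `|Q 0 i| * `|invmx A i j|.
pose N := Num.truncn M.
pose f (z : 'rV['I_(N + N).+1]_n) : 'rV[R]_n :=
  map_mx intr (\row_j ((z 0 j)%:Z - N%:Z)) *m A.
apply: (@sub_finite_set _ _ (f @` setT)); last exact/finite_image/finite_finset.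
move=> x [Qx [z _ zx]].
have zN j : `|z 0 j| <= N%:Z.
  have zE : (z 0 j)%:~R = \sum_(i < n) x 0 i * invmx A i j.
    have := congr1 (fun y => (y *m invmx A) 0 j) zx.
    by rewrite mulmxK// !mxE.
  have zM : `|(z 0 j)%:~R| <= M.
    rewrite zE (le_trans (ler_norm_sum _ _ _))// ler_sum// => i _.
    rewrite (bigD1 j)//= normrM ler_wpDr ?sumr_ge0//.
    apply: ler_wpM2r; first exact: normr_ge0.
    have /andP[lo hi] := Qx i; rewrite ler_norml.
    rewrite (le_trans hi (ler_norm _)) andbT (le_trans _ lo)//.
    by rewrite lerN2 ler_norm.
  have : `|z 0 j| < N.+1%:Z.
    rewrite -(ltr_int R) intr_norm (le_lt_trans zM)//.
    by rewrite -pmulrn; apply: truncnS_gt.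
  by rewrite -(addn1 N) PoszD ltzD1.
exists (\row_j inord (absz (z 0 j + N%:Z))) => //.
rewrite -zx /f; congr (_ *m _); congr map_mx; apply/rowP => j; rewrite !mxE.
have := zN j; rewrite ler_norml => /andP[lo hi].
have z0 : 0 <= z 0 j + N%:Z by rewrite -lerBlDr sub0r.
rewrite inordK; first by rewrite gez0_abs// addrK.
by rewrite ltnS -lez_nat gez0_abs// PoszD lerD2r.
Qed.

(* Main.v *)
(* The lattice is spanned by e_1, ..., e_{n-1} and (theta, 1); write b for the
   last coordinate of its points. At each scale m, theta is within m^-19 of a
   vector theta' that produces far too many lattice points in a tall box whose
   cross-section has side of order 1/m.
   For n = 2, theta' = l/m with l coprime to m. The multiples of
   (m theta - l, m) give m^2 points with 0 <= b <= m^3, against a volume of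
   m^2/4, and with B = m the right-hand side is O(m^2) because |x_1| >= 1/(2m)
   for 0 < |b| < m.
   For n = 3, theta' = ((p + sqrt 2)/m, (l - p - sqrt 2)/m). If m does not
   divide b, then x_1 + x_2 is close to a nonzero multiple of 1/m, so one of
   the |x_i| is at least 1/(4m) and the other is at least 1/(8|b|m), since
   sqrt 2 is badly approximable. If b = mj, then x_1 and -x_2 are both close
   to numbers of the form a + j sqrt 2 with a an integer, so
   |x_i| >= 1/(8|j|). Hence |x_1 x_2 b| >= 1/(64 m^2) for 0 < |b| < m^4, and
   with B = m^4 the right-hand side is O(m^4). The pigeonhole principle for
   j sqrt 2 mod 1 yields m^4/80 points with b = mj and |b| <= m^6, against a
   volume of m^4/512.
   A single theta serves infinitely many scales by letting m grow along
   m_{k+1} = m_k^20. *)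

Require Import Defs.
From HB Require Import structures.
From mathcomp Require Import all_boot all_order all_algebra finmap.
From mathcomp Require Import all_classical all_reals all_analysis.
From mathcomp Require Import ring lra zify.

Set Implicit Arguments.
Unset Strict Implicit.
Unset Printing Implicit Defensive.

Import Order.TTheory GRing.Theory Num.Theory.
Import numFieldNormedType.Exports.

Local Open Scope classical_set_scope.
Local Open Scope ring_scope.

(** * Roots, norms and point counts *)

Lemma rootK (R : realType) (n : nat) (z : R) :
  (0 < n)%N -> 0 <= z -> (z ^+ n) `^ n%:R^-1 = z.
Proof.
move=> n0 z0; rewrite -powR_mulrn// -powRrM mulfV ?powRr1//.
by rewrite pnatr_eq0 -lt0n.
Qed.

Lemma root_ge (R : realType) (n : nat) (z y : R) :
  (0 < n)%N -> 0 <= z -> z ^+ n <= y -> z <= y `^ n%:R^-1.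
Proof.
move=> n0 z0 zy; rewrite -[leLHS](@rootK _ n)//.
have z0' : 0 <= z ^+ n by rewrite exprn_ge0.
by rewrite ge0_ler_powR ?invr_ge0 ?nnegrE// (le_trans z0').
Qed.

Lemma coord_le_enorm (R : realType) (n : nat) (x : 'rV[R]_n) (i : 'I_n) :
  `|x 0 i| <= enorm x.
Proof.
rewrite /enorm -sqrtr_sqr ler_wsqrtr// (bigD1 i)//= lerDl.
by rewrite sumr_ge0// => j _; rewrite sqr_ge0.
Qed.

Lemma size_le_box_count (R : realType) (n : nat) (L : set 'rV[R]_n)
    (Q : 'rV[R]_n) (s : seq 'rV[R]_n) :
  is_lattice L -> uniq s -> (forall x, x \in s -> (box Q `&` L) x) ->
  (size s <= box_count L Q)%N.
Proof.
move=> Ll us sQ; apply: uniq_leq_size => // x /sQ xQ.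
by rewrite in_fset_set ?inE//; exact: finite_box_lattice.
Qed.

(** * Sheared integer lattices *)

(** The rows form the basis, and only the last one differs from a unit vector. Here [theta] has full
    length; later lemmas require its last entry to be 0. *)
Definition shear (R : realType) (N : nat) (theta : 'rV[R]_N.+1) :
  'M[R]_N.+1 := 1%:M + delta_mx ord_max 0 *m theta.

Definition shear_lattice (R : realType) (N : nat) (theta : 'rV[R]_N.+1) :
  set 'rV[R]_N.+1 := [set map_mx intr z *m shear theta | z in setT].

Lemma shear_row (R : realType) (N : nat) (theta : 'rV[R]_N.+1)
    (v : 'rV[int]_N.+1) (i : 'I_N.+1) :
  (map_mx intr v *m shear theta) 0 i =
  (v 0 i)%:~R + (v 0 ord_max)%:~R * theta 0 i.
Proof.
rewrite /shear mulmxDr mulmx1 mulmxA mxE; congr (_ + _); first by rewrite mxE.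
rewrite mxE big_ord1; congr (_ * _).
rewrite mxE (bigD1 ord_max)//= !mxE !eqxx mulr1.
by rewrite big1 ?addr0// => j jm; rewrite !mxE (negPf jm) mulr0.
Qed.

Lemma det_shear (R : realType) (N : nat) (theta : 'rV[R]_N.+1) :
  theta 0 ord_max = 0 -> \det (shear theta) = 1.
Proof.
move=> t0; rewrite det_trig.
  apply: big1 => i _; rewrite !mxE big_ord1 !mxE eqxx andbT.
  by have [->|_] := eqVneq i ord_max; rewrite ?t0 ?mulr0 ?mul0r addr0.
apply/is_trig_mxP => i j ij; rewrite !mxE big_ord1 !mxE.
have /negPf -> : i != j by rewrite neq_ltn ij.
have /negPf -> : i != ord_max.
  by rewrite neq_ltn (leq_trans ij)//= -ltnS ltn_ord.
by rewrite mul0r addr0.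
Qed.

Lemma shear_basis (R : realType) (N : nat) (theta : 'rV[R]_N.+1) :
  theta 0 ord_max = 0 -> is_lattice_basis (shear_lattice theta) (shear theta).
Proof. by move=> t0; split => //; rewrite unitmxE det_shear// unitr1. Qed.

Lemma last_coord0E (R : realType) (N : nat) (x : 'rV[R]_N.+1) :
  @last_coord0 R N.+1 x <-> x 0 ord_max = 0.
Proof.
split=> [|x0 i [iN]]; first by apply.
by have -> : i = ord_max by apply: val_inj.
Qed.

(** When the last coefficient vanishes, [theta] drops out, so the point is a nonzero integer
    vector. *)
Lemma lambda1_shear (R : realType) (N : nat) (theta : 'rV[R]_N.+1) :
  theta 0 ord_max = 0 ->
  (1 <= lambda1 (shear_lattice theta `&` @last_coord0 R N.+1))%E.
Proof.
move=> t0; apply: le_ereal_inf_tmp => _ [x [[[v _ vx] /last_coord0E xm] x0] <-].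
rewrite lee_fin; move: xm; rewrite -vx shear_row t0 mulr0 addr0 => vm.
have xE i : x 0 i = (v 0 i)%:~R by rewrite -vx shear_row vm mul0r addr0.
have /existsP[i vi] : [exists i, v 0 i != 0].
  apply: contra_notT x0 => /existsPn v0; apply/rowP => i.
  by rewrite xE mxE; have := v0 i; rewrite negbK => /eqP ->.
rewrite vx; apply: le_trans (coord_le_enorm x i).
by rewrite xE -intr_norm ler1z -gtz0_ge1 normr_gt0.
Qed.

Lemma nu_shear (R : realType) (N : nat) (theta : 'rV[R]_N.+1) (B mu0 rho : R) :
  theta 0 ord_max = 0 -> 0 <= mu0 -> rho <= B ->
  (forall v : 'rV[int]_N.+1, v 0 ord_max != 0 -> `|v 0 ord_max|%:~R < B ->
    mu0 ^+ N.+1 <= `|\prod_i ((v 0 i)%:~R + (v 0 ord_max)%:~R * theta 0 i)|) ->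
  (mu0%:E <= nu (@last_coord0 R N.+1) (shear_lattice theta) rho)%E.
Proof.
move=> t0 mu00 rB h; apply: le_ereal_inf_tmp => _ [x [[[v _ vx] xC] xr] <-].
have xm : x 0 ord_max = (v 0 ord_max)%:~R.
  by rewrite -vx shear_row t0 mulr0 addr0.
rewrite lee_fin; apply: root_ge => //.
rewrite -vx (eq_bigr _ (fun i _ => shear_row _ _ i)); apply: h.
  by apply: contra_not_neq xC => v0; apply/last_coord0E; rewrite xm v0.
rewrite intr_norm -xm; apply: le_lt_trans (coord_le_enorm _ _) _.
exact: lt_le_trans rB.
Qed.

(** * The error term and tall boxes *)

(** A single admissible [B] bounds the infimum from above, and the error term decreases as [mu]
    grows. *)
Lemma inf_error_term (R : realType) (n : nat) (C L : set 'rV[R]_n)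
    (q H B mu0 : R) (N : nat) :
  0 <= q -> 0 < B <= H -> 0 < mu0 -> (mu0%:E <= mu C L B)%E ->
  (ereal_inf [set (q%:E / mu C L b + (H / b)%:E) ^+ N
             | b in [set b : R | (0 < b <= H)%R]]
   <= ((q / mu0 + H / B) ^+ N)%:E)%E.
Proof.
move=> q0 /andP[B0 BH] mu0_gt0 mu_ge.
apply: (@le_trans _ _ ((q%:E / mu C L B + (H / B)%:E) ^+ N)%E).
  by apply: ereal_inf_lbound; exists B => //=; rewrite B0.
have H0 : 0 < H by exact: lt_le_trans BH.
have HB : 0 <= H / B by rewrite divr_ge0 ?ltW.
(* If [mu] is infinite, the first summand is 0; the value minus infinity contradicts the lower
   bound. *)
move: mu_ge; case: (mu C L B) => [r| |//]; last first.
  rewrite invey mule0 add0e -EFin_expe lee_fin => _.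
  have qm : 0 <= q / mu0 by rewrite divr_ge0// ltW.
  by rewrite lerXn2r ?nnegrE ?addr_ge0// lerDr.
rewrite lee_fin => mr; have r0 : 0 < r by exact: lt_le_trans mr.
rewrite inver gt_eqF// -EFinM -EFinD -EFin_expe lee_fin.
have qr : 0 <= q / r by rewrite divr_ge0// ltW.
have qm : 0 <= q / mu0 by rewrite divr_ge0// ltW.
by rewrite lerXn2r ?nnegrE ?addr_ge0// lerD2r ler_wpM2l// lef_pV2.
Qed.

Definition tall_box (R : realType) (N : nat) (w H : R) : 'rV[R]_N.+1 :=
  \row_i (if i == ord_max then H else w).

Lemma prod_tall (R : realType) (N : nat) (w H : R) :
  \prod_(i < N.+1) (tall_box N w H) 0 i = w ^+ N * H.
Proof.
rewrite big_ord_recr/= mxE eqxx; congr (_ * _).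
rewrite (eq_bigr (fun=> w)) ?prodr_const ?card_ord// => i _.
rewrite mxE; case: eqP => // /(congr1 val)/= iN.
by have := ltn_ord i; rewrite iN ltnn.
Qed.

Lemma Qbar_tall (R : realType) (N : nat) (w H z : R) :
  0 <= z -> w ^+ N * H = z ^+ N.+1 -> Qbar (tall_box N w H) = z.
Proof. by move=> z0 wH; rewrite /Qbar prod_tall wH rootK. Qed.

Lemma Qmax_tall (R : realType) (N : nat) (w H : R) :
  0 <= H -> w <= H -> Qmax (tall_box N w H) = H.
Proof.
move=> H0 wH; apply/eqP; rewrite eq_le /Qmax; apply/andP; split.
  by apply: bigmax_le => // i _; rewrite mxE; case: ifP.
apply: (@bigmax_sup _ _ _ _ ord_max) => //; by rewrite mxE eqxx.
Qed.

Lemma box_vol_tall (R : realType) (N : nat) (w H : R) :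
  box_vol (tall_box N w H) = 2 ^+ N.+1 * (w ^+ N * H).
Proof.
have -> : 2 ^+ N.+1 = \prod_(i < N.+1) (2 : R) by rewrite prodr_const card_ord.
rewrite -prod_tall /box_vol -big_split/=.
by apply: eq_bigr => i _; rewrite opprK mulr2n mulrDl mul1r.
Qed.

(** * Reduction to numerical data at each scale *)

Definition sharp_example (R : realType) (n : nat) (c : R) : Prop :=
  exists (L : set 'rV[R]_n) (Q : nat -> 'rV[R]_n),
    [/\ is_lattice L, lattice_det L = 1
      & weakly_admissible (@last_coord0 R n) L] /\
    [/\ forall k (i : 'I_n), 0 < Q k 0 i,
        forall k (i : 'I_n), (i.+1 < n)%N -> Q k 0 i <= Qbar (Q k),
        Qbar (Q k) / Qmax (Q k) @[k --> \oo] --> (0 : R),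
        box_vol (Q k) @[k --> \oo] --> +oo
      & forall k : nat,
        (c%:E *
           ereal_inf [set ((Qbar (Q k))%:E / mu (@last_coord0 R n) L B
                           + (Qmax (Q k) / B)%:E) ^+ n.-1
                     | B in [set B : R | (0 < B <= Qmax (Q k))%R]]
         <= (`|(box_count L (Q k))%:R - box_vol (Q k) / lattice_det L|%R)%:E)%E].

(** At scale k, the box has half-sides [w] (N times) and [H], and [z] is its [Qbar]; [B] is the
    competitor in the infimum, [mu0] a lower bound for [mu], and [s] lists integer coordinates of
    lattice points in the box. The last hypothesis says that these points alone exceed the volume by
    the required amount. *)
Lemma sharp_of_shear (R : realType) (N : nat) (c : R) (theta : 'rV[R]_N.+1)
    (w H z B mu0 : nat -> R) (s : nat -> seq 'rV[int]_N.+1) :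
  (0 < N)%N -> 0 <= c -> theta 0 ord_max = 0 ->
  (forall k, [/\ 0 < w k, w k <= z k, z k <= H k
    & w k ^+ N * H k = z k ^+ N.+1]) ->
  (forall k, (k.+1)%:R * z k <= H k) ->
  (forall k, k%:R <= 2 ^+ N.+1 * z k ^+ N.+1) ->
  (forall k, [/\ 0 < B k, B k <= H k & k%:R <= B k]) ->
  (forall k, 0 < mu0 k <= 1) ->
  (forall k (v : 'rV[int]_N.+1), v 0 ord_max != 0 ->
    `|v 0 ord_max|%:~R < B k ->
    mu0 k ^+ N.+1 <=
      `|\prod_i ((v 0 i)%:~R + (v 0 ord_max)%:~R * theta 0 i)|) ->
  (forall k, uniq (s k)) ->
  (forall k v, v \in s k ->
    `|v 0 ord_max|%:~R <= H k /\ forall i, i != ord_max ->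
    `|(v 0 i)%:~R + (v 0 ord_max)%:~R * theta 0 i| <= w k) ->
  (forall k, c * (z k / mu0 k + H k / B k) ^+ N + 2 ^+ N.+1 * z k ^+ N.+1
     <= (size (s k))%:R) ->
  sharp_example N.+1 c.
Proof.
move=> N0 c0 t0 wzH Hz zinf BH mu01 nuB us sw cs.
have Lb := shear_basis t0.
have Ll : is_lattice (shear_lattice theta) by exists (shear theta).
have det1 : lattice_det (shear_lattice theta) = 1.
  by rewrite (lattice_detE Lb) det_shear// normr1.
have z0 k : 0 < z k by have [w0 wz _ _] := wzH k; exact: lt_le_trans wz.
have H0 k : 0 < H k by have [_ _ zH _] := wzH k; exact: lt_le_trans zH.
have qbar k : Qbar (tall_box N (w k) (H k)) = z k.
  by apply: Qbar_tall; [exact: ltW|have [] := wzH k].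
have qmax k : Qmax (tall_box N (w k) (H k)) = H k.
  apply: Qmax_tall; first exact: ltW.
  by have [_ wz zH _] := wzH k; exact: le_trans zH.
have vol k : box_vol (tall_box N (w k) (H k)) = 2 ^+ N.+1 * z k ^+ N.+1.
  by rewrite box_vol_tall; have [_ _ _ ->] := wzH k.
exists (shear_lattice theta), (fun k => tall_box N (w k) (H k)); split; split => //.
(* Since [B k] is at least k, the scale [(Num.truncn rho).+1] covers the radius [rho]. *)
- move=> rho rho0; have [_ _ kB] := BH (Num.truncn rho).+1.
  have /andP[mu0_gt0 _] := mu01 (Num.truncn rho).+1.
  apply: (@lt_le_trans _ _ (mu0 (Num.truncn rho).+1)%:E); first by rewrite lte_fin.
  apply: nu_shear (nuB _) => //; first exact: ltW.
  by apply: le_trans kB; apply/ltW/truncnS_gt.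
- by move=> k i; rewrite mxE; case: ifP => // _; have [] := wzH k.
- move=> k i iN; rewrite qbar mxE; case: eqP => [iE|_]; last by have [] := wzH k.
  by move: iN; rewrite iE ltnn.
- under eq_fun do rewrite qbar qmax.
  apply: (@squeeze_cvgr _ _ _ _ (fun=> 0) (@harmonic R)).
  + near=> k; apply/andP; split; first by rewrite divr_ge0// ltW.
    by rewrite /= ler_pdivrMr// mulrC ler_pdivlMr ?ltr0n// mulrC.
  + exact: cvg_cst.
  + exact: cvg_harmonic.
- under eq_fun do rewrite vol.
  apply/cvgryPge => A; near=> k.
  apply: (@le_trans _ _ k%:R).
    by near: k; exact: nbhs_infty_ger.
  exact: zinf.
- move=> k; rewrite qbar qmax vol det1 divr1.
  have [B0 BH' _] := BH k; have /andP[mu0_gt0 mu0_le1] := mu01 k.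
  have muB : ((mu0 k)%:E <= mu (@last_coord0 R N.+1) (shear_lattice theta) (B k))%E.
    rewrite le_min (le_trans _ (lambda1_shear _)) ?lee_fin//=.
    by apply: nu_shear (nuB k) => //; exact: ltW.
  have BH2 : 0 < B k <= H k by rewrite B0.
  have /(lee_wpmul2l _) := inf_error_term N (ltW (z0 k)) BH2 mu0_gt0 muB.
  move=> /(_ c%:E); rewrite lee_fin => /(_ c0) /le_trans; apply.
  rewrite -EFinM lee_fin; apply: le_trans (ler_norm _); rewrite lerBrDr.
  apply: le_trans (cs k) _; rewrite ler_nat.
  have inj : injective (fun v : 'rV[int]_N.+1 => map_mx intr v *m shear theta).
    move=> u v /(congr1 (mulmx^~ (invmx (shear theta)))).
    have [uA _] := Lb; rewrite !mulmxK//.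
    by move/rowP => uv; apply/rowP => i; have := uv i; rewrite !mxE => /intr_inj.
  rewrite -(size_map (fun v : 'rV[int]_N.+1 => map_mx intr v *m shear theta)).
  apply: size_le_box_count => //; first by rewrite map_inj_uniq.
  move=> x /mapP[v vs ->]; split; last by exists v.
  move=> i; rewrite -ler_norml [leRHS]mxE shear_row; have [vH vw] := sw _ _ vs.
  have [->|im] := eqVneq i ord_max; last exact: vw.
  by rewrite t0 mulr0 addr0 -intr_norm.
Unshelve. all: by end_near.
Qed.

(** * Diophantine lower bounds *)

(** The 2-adic valuation is even on the left and odd on the right. *)
Lemma sqr_neq_double_sqr (a j : nat) : (0 < j)%N -> (a ^ 2 != 2 * j ^ 2)%N.
Proof.
move=> j0; apply/eqP => e.
have a0 : (0 < a)%N by case: a e => //; rewrite exp0n//; nia.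
have := congr1 (logn 2) e; rewrite lognM ?expn_gt0 ?j0// !lognX.
by move/(congr1 odd); rewrite oddD !oddM.
Qed.

(** The product with the conjugate is the nonzero integer a^2 - 2j^2, and the conjugate exceeds the
    number itself by at most 3|j| in absolute value. *)
Lemma dist_sqrt2 (R : realType) (a j : int) : j != 0 ->
  1 <= 4 * `|j|%:~R * `|a%:~R + j%:~R * Num.sqrt (2 : R)|.
Proof.
move=> j0; set b := Num.sqrt 2.
have b2 : b ^+ 2 = 2 by rewrite sqr_sqrtr.
have b0 : 0 <= b by exact: sqrtr_ge0.
have bs : b <= 3 / 2 by rewrite -(ler_sqr b0) ?nnegrE; [rewrite b2; lra|lra].
have prod_ge1 : 1 <= `|a%:~R + j%:~R * b| * `|a%:~R - j%:~R * b|.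
  rewrite -normrM mulrC -subr_sqr exprMn b2 -!rmorphXn.
  have -> : (2 : R) = (2 : int)%:~R by [].
  rewrite -rmorphM -rmorphB -intr_norm ler1z -gtz0_ge1 normr_gt0 subr_eq0.
  apply/eqP => /(congr1 absz); rewrite abszM !abszX => e.
  have := @sqr_neq_double_sqr `|a|%N `|j|%N; rewrite absz_gt0 => /(_ j0).
  by rewrite e mulnC eqxx.
have j1 : 1 <= `|j|%:~R :> R by rewrite ler1z -gtz0_ge1 normr_gt0.
have tri : `|a%:~R - j%:~R * b| <= `|a%:~R + j%:~R * b| + 3 * `|j|%:~R.
  have -> : a%:~R - j%:~R * b = (a%:~R + j%:~R * b) - 2 * (j%:~R * b) by ring.
  apply: le_trans (ler_normB _ _) _; rewrite lerD2l !normrM -intr_norm (ger0_norm b0).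
  by rewrite ger0_norm//; nra.
have x0 := normr_ge0 (a%:~R + j%:~R * b).
(* Otherwise the product would be below 1/16 + 3/4. *)
rewrite leNgt; apply/negP => h; nra.
Qed.

(** m(a + b theta) lies within 1/2 of the integer ma + bl, which is nonzero because m does not
    divide bl. *)
Lemma dist_rational (R : realType) (m l a b : int) (theta : R) :
  ~~ (m %| b * l)%Z -> 0 < m ->
  2 * `|b|%:~R * `|m%:~R * theta - l%:~R| <= 1 ->
  1 <= 2 * m%:~R * `|a%:~R + b%:~R * theta|.
Proof.
move=> mbl m0 err.
have ne : m * a + b * l != 0.
  apply: contraNneq mbl => e; have -> : b * l = (- a) * m by lia.
  by rewrite dvdz_mull.
have ge1 : 1 <= `|(m * a + b * l)%:~R| :> R.
  by rewrite -intr_norm ler1z -gtz0_ge1 normr_gt0.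
have m0' : 0 <= m%:~R :> R by rewrite ler0z ltW.
rewrite -mulrA -[X in X * `|_|](ger0_norm m0') -normrM.
have -> : m%:~R * (a%:~R + b%:~R * theta) =
    (m * a + b * l)%:~R - b%:~R * (l%:~R - m%:~R * theta) :> R.
  by rewrite rmorphD !rmorphM/=; ring.
have := lerB_dist ((m * a + b * l)%:~R : R) (b%:~R * (l%:~R - m%:~R * theta)).
rewrite (normrM b%:~R) (distrC l%:~R) -intr_norm; lra.
Qed.

(** m(a + b theta) differs by at most 1/(8|b|) from (ma + bp) + bq sqrt 2, which is at least
    1/(4|b|) in absolute value by [dist_sqrt2]. *)
Lemma dist_sqrt2_approx (R : realType) (m p q a b : int) (theta : R) :
  b != 0 -> `|q| = 1 -> 0 < m ->
  8 * `|b|%:~R ^+ 2 * `|m%:~R * theta - (p%:~R + q%:~R * Num.sqrt 2)| <= 1 ->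
  1 <= 8 * `|b|%:~R * m%:~R * `|a%:~R + b%:~R * theta|.
Proof.
move=> b0 q1 m0; set d := m%:~R * theta - _ => err.
have bq : b * q != 0 by rewrite mulf_neq0// -normr_gt0 q1.
have := @dist_sqrt2 R (m * a + b * p) _ bq; rewrite normrM q1 mulr1.
set y := _ + _ * Num.sqrt 2 => y4.
have m0' : 0 <= m%:~R :> R by rewrite ler0z ltW.
rewrite -mulrA -[X in X * `|_|](ger0_norm m0') -normrM.
have -> : m%:~R * (a%:~R + b%:~R * theta) = y - (b%:~R * - d) :> R.
  by rewrite /y /d rmorphD !rmorphM/=; ring.
have := lerB_dist y (b%:~R * - d); rewrite (normrM b%:~R) normrN -intr_norm.
have b1 : 1 <= `|b|%:~R :> R by rewrite ler1z -gtz0_ge1 normr_gt0.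
set x := `|y - _|; set B := `|b|%:~R in err y4 b1 *; set D := `|d| in err *.
move=> h; have : 8 * B * (`|y| - B * D) <= 8 * B * x by rewrite ler_wpM2l//; lra.
lra.
Qed.

Lemma norm_form_lower_bound (R : realType) (m l p a1 a2 b : int) (t1 t2 : R) :
  0 < m -> coprimez l m -> b != 0 -> `|b| <= m ^+ 4 ->
  16 * m%:~R ^+ 8 * `|m%:~R * t1 - (p%:~R + Num.sqrt 2)| <= 1 ->
  16 * m%:~R ^+ 8 * `|m%:~R * t2 - ((l - p)%:~R - Num.sqrt 2)| <= 1 ->
  1 <= 64 * m%:~R ^+ 2 *
       (`|a1%:~R + b%:~R * t1| * `|a2%:~R + b%:~R * t2| * `|b|%:~R).
Proof.
move=> m0 cop b0 bm.
set d1 := `|_ - _|; set d2 := `|_ - _| => e1 e2.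
have d10 : 0 <= d1 by exact: normr_ge0.
have d20 : 0 <= d2 by exact: normr_ge0.
have m1 : 1 <= m%:~R :> R by rewrite ler1z -gtz0_ge1.
have b1 : 1 <= `|b|%:~R :> R by rewrite ler1z -gtz0_ge1 normr_gt0.
have bm' : `|b|%:~R <= m%:~R ^+ 4 :> R by rewrite -rmorphXn ler_int.
have bm2 : `|b|%:~R ^+ 2 <= m%:~R ^+ 8 :> R.
  by rewrite -[8%N]/(4 * 2)%N exprM lerXn2r ?nnegrE//; lra.
have D1 : d1 = `|m%:~R * t1 - (p%:~R + (1 : int)%:~R * Num.sqrt 2)|.
  by rewrite /d1 mul1r.
have D2 : d2 = `|m%:~R * t2 - ((l - p)%:~R + (- 1 : int)%:~R * Num.sqrt 2)|.
  by rewrite /d2 rmorphN mulN1r.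
set x1 := _ + _ * t1; set x2 := _ + _ * t2.
(* If b = jm, the approximation of m t1 and m t2 is used with denominator 1. This gives |x1 x2 b| >=
   m/(64|j|), and |j| <= m^3. *)
have [/dvdzP[j bE]|mb] := boolP (m %| b)%Z.
  have j0 : j != 0 by apply: contraNneq b0; rewrite bE => ->; rewrite mul0r.
  have jb : `|j| <= `|b| by rewrite bE normrM ler_peMr// -gtz0_ge1 normr_gt0 gt_eqF.
  have jb' : `|j|%:~R ^+ 2 <= `|b|%:~R ^+ 2 :> R.
    by rewrite lerXn2r ?nnegrE ?ler0z// ler_int.
  have h1 : 1 <= 8 * `|j|%:~R * `|x1|.
    have := @dist_sqrt2_approx R 1 p 1 a1 j (m%:~R * t1) j0 erefl isT.
    rewrite mulr1z !mul1r mulr1 /x1 bE rmorphM/= mulrA; apply.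
    by rewrite -/d1; nra.
  have h2 : 1 <= 8 * `|j|%:~R * `|x2|.
    have := @dist_sqrt2_approx R 1 (l - p) (-1) a2 j (m%:~R * t2) j0 erefl isT.
    rewrite mulr1z !mul1r mulr1 rmorphN mulN1r /x2 bE.
    rewrite [in X in _ -> X]rmorphM/= mulrA.
    by apply; rewrite -/d2; nra.
  have bj : `|b|%:~R = `|j|%:~R * m%:~R :> R.
    by rewrite bE normrM rmorphM/= (gtr0_norm m0).
  have j1 : 1 <= `|j|%:~R :> R by rewrite ler1z -gtz0_ge1 normr_gt0.
  have jm : `|j|%:~R <= m%:~R ^+ 3 :> R.
    by rewrite -(ler_pM2r (lt_le_trans ltr01 m1)) -exprSr -bj.
  set J := `|j|%:~R in h1 h2 bj j1 jm *; rewrite bj.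
  have h12 : 1 <= (8 * J * `|x1|) * (8 * J * `|x2|) by nra.
  rewrite -(ler_pM2l (lt_le_trans ltr01 j1)) mulr1.
  apply: le_trans jm _.
  have -> : J * (64 * m%:~R ^+ 2 * (`|x1| * `|x2| * (J * m%:~R))) =
    m%:~R ^+ 3 * ((8 * J * `|x1|) * (8 * J * `|x2|)) by ring.
  by rewrite ler_peMr// exprn_ge0//; lra.
have h1 : 1 <= 8 * `|b|%:~R * m%:~R * `|x1|.
  by apply: (@dist_sqrt2_approx R m p 1) => //; rewrite -D1; nra.
have h2 : 1 <= 8 * `|b|%:~R * m%:~R * `|x2|.
  by apply: (@dist_sqrt2_approx R m (l - p) (-1)) => //; rewrite -D2; nra.
(* In the sum the multiples of sqrt 2 cancel, so t1 + t2 is close to the rational l/m. *)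
have h3 : 1 <= 2 * m%:~R * `|x1 + x2|.
  have -> : x1 + x2 = (a1 + a2)%:~R + b%:~R * (t1 + t2).
    by rewrite rmorphD /x1 /x2/=; ring.
  apply: (@dist_rational R m l) => //.
    by rewrite Gauss_dvdzl// coprimez_sym.
  have : `|m%:~R * (t1 + t2) - l%:~R| <= d1 + d2.
    apply: le_trans (ler_normD _ _); rewrite le_eqVlt; apply/orP; left.
    by apply/eqP; congr `|_|; rewrite rmorphB/=; ring.
  have : m%:~R ^+ 4 <= m%:~R ^+ 8 :> R by rewrite ler_weXn2l.
  set D := `|_ - _|; set M4 := _ ^+ 4 in bm' *; set M8 := _ ^+ 8 in e1 e2 *.
  set bb := `|b|%:~R in bm' b1 *.
  move=> MM DD; have D0 : 0 <= D by exact: normr_ge0.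
  have : bb * D <= M8 * (d1 + d2) by apply: ler_pM => //; lra.
  lra.
have h4 : `|x1 + x2| <= `|x1| + `|x2| by exact: ler_normD.
have := normr_ge0 x1; have := normr_ge0 x2.
move: h1 h2 h3 h4; set X1 := `|x1|; set X2 := `|x2|; set S := `|x1 + x2|.
set bb := `|b|%:~R in b1 *; set M := m%:~R in m1 *.
clearbody X1 X2 S bb M; clear -b1 m1 => h1 h2 h3 h4 X20 X10.
have : 1 <= 2 * M * (X1 + X2) by nra.
rewrite mulrDr => h5.
(* The larger factor is at least 1/(4m) and the other at least 1/(8|b|m), which gives 1/(32 m^2)
   after multiplying by |b|. *)
have [h|h] := leP (1/2) (2 * M * X1).
  have : 1/2 * 1 <= (2 * M * X1) * (8 * bb * M * X2) by apply: ler_pM => //; lra.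
  lra.
have : 1/2 * 1 <= (2 * M * X2) * (8 * bb * M * X1) by apply: ler_pM => //; lra.
lra.
Qed.

(** * Counting good multiples by pigeonhole *)

Lemma pigeonhole (J N : nat) (f : 'I_J -> 'I_N) : (0 < J)%N ->
  exists y, (J <= N * #|[pred i | f i == y]|)%N.
Proof.
case: J f => // J f _.
pose y := [arg max_(y > f ord0) #|[pred i | f i == y]|]; exists y.
rewrite -[leqLHS]card_ord -sum1_card (partition_big f predT)//=.
rewrite -[X in (_ <= X * _)%N]card_ord -sum_nat_const; apply: leq_sum => i _.
rewrite sum1_card /y; by case: arg_maxnP => // y' _ /(_ i isT).
Qed.

(** The fractional parts of ib for 0 <= i <= J are sorted into N intervals of length 1/N.
    Subtracting one fixed index of the fullest interval from all its indices yields many distinct j,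
    not just one. *)
Lemma dirichlet_count (R : realType) (b : R) (J N : nat) : (0 < N)%N ->
  exists s : seq int, [/\ uniq s, (J.+1 <= N * size s)%N &
    forall j, j \in s -> `|j| <= J%:Z /\
      exists a : int, N%:R * `|a%:~R + j%:~R * b| <= 1].
Proof.
case: N => // N _.
pose frac (i : nat) : R := i%:R * b - (Num.floor (i%:R * b))%:~R.
have frac0 i : 0 <= frac i by rewrite subr_ge0 floor_le_tmp.
have frac1 i : frac i < 1 by rewrite ltrBlDr addrC -intrD1 floorD1_gt.
pose g (i : nat) := Num.truncn (N.+1%:R * frac i).
have gP i : (g i)%:R <= N.+1%:R * frac i < (g i).+1%:R.
  by apply: truncn_itv; rewrite mulr_ge0.
have gN i : (g i < N.+1)%N.
  rewrite -(ltr_nat R); have /andP[/le_lt_trans ->//] := gP i.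
  by rewrite gtr_pMr// ltr0n.
have [y Hy] := @pigeonhole J.+1 N.+1 (fun i => Ordinal (gN i)) isT.
set A := [pred i | _] in Hy.
have /card_gt0P[i0 i0A] : (0 < #|A|)%N by case: #|A| Hy => //; rewrite muln0.
exists [seq (val i)%:Z - (val i0)%:Z | i <- enum A]; split.
- rewrite map_inj_uniq ?enum_uniq// => i i' /(congr1 (+%R^~ (val i0)%:Z)).
  by rewrite !subrK => -[] /val_inj.
- by rewrite size_map -cardE.
move=> j /mapP[i]; rewrite mem_enum => iA ->; split.
  have := ltn_ord i; have := ltn_ord i0; rewrite /=; lia.
exists (Num.floor (i0%:R * b) - Num.floor (i%:R * b)).
have gi : g i = y by move: iA; rewrite inE => /eqP <-.
have gi0 : g i0 = y by move: i0A; rewrite inE => /eqP <-.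
have := gP i; have := gP i0; rewrite gi gi0 -(addn1 y) natrD /frac.
rewrite -[X in X * `|_|](@ger0_norm _ N.+1%:R)// -normrM.
rewrite !rmorphB/= -!pmulrn => h1 h2; rewrite ler_norml; apply/andP; split; lra.
Qed.

(** * Scales and simultaneous approximation at all of them *)

Definition root_scale (k : nat) : nat := (2 ^ 20 ^ k)%N.

(* A cube, so that the cube roots in Qbar and nu come out rational for n = 3. *)
Definition scale (k : nat) : nat := (root_scale k ^ 3)%N.

Lemma root_scale_ge2 (k : nat) : (2 <= root_scale k)%N.
Proof. by rewrite -[leqLHS]/(2 ^ 1)%N leq_exp2l// expn_gt0. Qed.

Lemma root_scale_gt (k : nat) : (k < root_scale k)%N.
Proof. by apply: leq_ltn_trans (ltn_expl _ _) => //; apply/ltnW/ltn_expl. Qed.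

Lemma scale_ge8 (k : nat) : (8 <= scale k)%N.
Proof. by rewrite -[leqLHS]/(2 ^ 3)%N leq_exp2r// root_scale_ge2. Qed.

Lemma scaleS (k : nat) : scale k.+1 = (scale k ^ 20)%N.
Proof. by rewrite /scale /root_scale -!expnM expnSr; congr (_ ^ _)%N; lia. Qed.

Lemma nested_limit (R : realType) (x w : nat -> R) :
  (forall k, x k <= x k.+1) -> (forall k, w k.+1 <= w k) ->
  (forall k, x k <= w k) -> exists theta, forall k, x k <= theta <= w k.
Proof.
move=> xS wS xw.
have xn i j : (i <= j)%N -> x i <= x j.
  by apply: (@homo_leq _ _ (fun a b => a <= b)) => //; exact: le_trans.
have wn i j : (i <= j)%N -> w j <= w i.
  by apply: (@homo_leq _ _ (fun a b => b <= a)) => // a b c ab /le_trans; apply.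
have xwij i j : x i <= w j.
  have [/xn ij|/ltnW/wn ji] := leqP i j; first exact: le_trans (xw j).
  exact: le_trans (xw i) _.
exists (sup (range x)) => k; apply/andP; split.
  by apply: ub_le_sup; [exists (w 0%N) => _ [i _ <-]|exists k].
by apply: ge_sup; [exists (x 0%N); exists 0%N|move=> _ [i _ <-]].
Qed.

(** With M_k = [scale k], the fractions x_k = (p_k + b)/M_k increase by at most 2/M_{k+1}, so the
    intervals [x_k, x_k + 4/M_{k+1}] are nested. A common point is within 4/M_k^20 of each x_k. The
    case b = 0 gives rational approximations, b = sqrt 2 the shifted ones. *)
Lemma approx_limit (R : realType) (b : R) (p : nat -> int) :
  (forall k,
    0 <= (p k.+1)%:~R + b - (scale k)%:R ^+ 19 * ((p k)%:~R + b) <= 2) ->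
  exists theta, forall k,
    (scale k)%:R ^+ 19 * `|(scale k)%:R * theta - ((p k)%:~R + b)| <= 4.
Proof.
move=> step; pose M k : R := (scale k)%:R.
have M8 k : 8 <= M k by rewrite /M ler_nat scale_ge8.
have M0 k : 0 < M k by apply: lt_le_trans (M8 k).
have MS k : M k.+1 = M k ^+ 20 by rewrite /M scaleS natrX.
pose x k := ((p k)%:~R + b) / M k.
have xS k : 0 <= x k.+1 - x k <= 2 / M k.+1.
  have /andP[lo hi] := step k.
  have -> : x k.+1 - x k =
      ((p k.+1)%:~R + b - (scale k)%:R ^+ 19 * ((p k)%:~R + b)) / M k.+1.
    by rewrite /x MS -/(M k); field; exact: lt0r_neq0 (M0 k).
  by rewrite divr_ge0 ?(ltW (M0 _))//= ler_pM2r ?invr_gt0.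
have M2 k : 4 / M k.+1 <= 2 / M k.
  rewrite ler_pdivrMr// mulrAC ler_pdivlMr// MS.
  have : M k ^+ 2 <= M k ^+ 20 by rewrite ler_weXn2l//; have := M8 k; lra.
  have := M8 k; nra.
have [||k|theta thetaP] := @nested_limit R x (fun k => x k + 4 / M k.+1).
- by move=> k; have := xS k; lra.
- by move=> k; have := xS k; have := M2 k.+1; lra.
- by rewrite lerDl divr_ge0// ltW.
exists theta => k; rewrite -/(M k).
have -> : M k * theta - ((p k)%:~R + b) = M k * (theta - x k).
  by rewrite /x; field; exact: lt0r_neq0 (M0 k).
have /andP[lo hi] := thetaP k.
rewrite ger0_norm; last by rewrite mulr_ge0 ?subr_ge0// ltW.
rewrite mulrA -exprSr -MS mulrC.
by rewrite -ler_pdivlMr// lerBlDl.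
Qed.

Lemma exists_liouville (R : realType) : exists (lambda : R) (l : nat -> int),
  forall k, coprimez (l k) (scale k) /\
    (scale k)%:R ^+ 19 * `|(scale k)%:R * lambda - (l k)%:~R| <= 4.
Proof.
(* The added 1 makes each new numerator coprime to the previous scale, hence to its 20th power. *)
pose l := fix l k : int :=
  if k is k'.+1 then l k' * (scale k')%:Z ^+ 19 + 1 else 1.
have [k|lambda H] := @approx_limit R 0 l.
  rewrite [l k.+1]/= !addr0 rmorphD rmorphM rmorphXn/= -pmulrn.
  by rewrite mulrC addrAC subrr add0r ler01 ler1n.
exists lambda, l => k; split; last by have := H k; rewrite addr0.
case: k => [|k]; first by rewrite /= /coprimez gcd1z.
rewrite scaleS [l _]/=.
have -> : ((scale k ^ 20)%N : int) = (scale k)%:Z ^+ 20 by rewrite -rmorphXn/= natrXE.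
rewrite coprimezXr// coprimez_sym exprSr mulrA.
by rewrite /coprimez gcdzMDl gcdz1.
Qed.

Lemma exists_sqrt2_approx (R : realType) : exists (theta : R) (p : nat -> int),
  forall k,
    (scale k)%:R ^+ 19 * `|(scale k)%:R * theta - ((p k)%:~R + Num.sqrt 2)| <= 4.
Proof.
pose b : R := Num.sqrt 2.
(* Rounding down leaves a step between sqrt 2 - 1 and sqrt 2, inside [0, 2]. *)
pose p := fix p k : int :=
  if k is k'.+1 then Num.floor ((scale k')%:R ^+ 19 * ((p k')%:~R + b)) else 0.
have [k|theta H] := @approx_limit R b p; last by exists theta, p.
rewrite [p k.+1]/=; set y := _ * _.
have lo : (Num.floor y)%:~R <= y by exact: floor_le_tmp.
have hi : y < (Num.floor y)%:~R + 1 by rewrite -intrD1 floorD1_gt.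
have b0 : 0 <= b by exact: sqrtr_ge0.
have b2 : b ^+ 2 = 2 by rewrite sqr_sqrtr.
apply/andP; split; nra.
Qed.

(** Four spare powers of M contribute 8^4 = 8 * 512. The bound 8 leaves room for a sum of two errors
    from [approx_limit]. *)
Lemma approx_error_small (R : realType) (M d : R) (e : nat) :
  8 <= M -> 0 <= d -> M ^+ 19 * d <= 8 -> (e <= 15)%N ->
  512 * (M ^+ e * d) <= 1.
Proof.
move=> M8 d0 h e15.
have Me : M ^+ e <= M ^+ 15 by rewrite ler_weXn2l//; lra.
have M4 : 8 ^+ 4 <= M ^+ 4 by rewrite lerXn2r ?nnegrE//; lra.
have e0 : 0 <= M ^+ e by rewrite exprn_ge0//; lra.
have : 8 ^+ 4 * (M ^+ e * d) <= M ^+ 4 * (M ^+ 15 * d).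
  apply: ler_pM => //; first exact: mulr_ge0.
  exact: ler_wpM2r.
rewrite [leRHS]mulrA -exprD => /le_trans/(_ h).
by set u := _ * d; rewrite -[4%N]/(1 + 3)%N exprD; lra.
Qed.

(** * Dimension two *)

Lemma sharp_dim2 (R : realType) : sharp_example 2 (200^-1 : R).
Proof.
have [lambda [l H]] := exists_liouville R.
pose M k : R := (scale k)%:R.
have M8 k : 8 <= M k by rewrite /M ler_nat scale_ge8.
have kM k : k%:R * 4 + 4 <= M k.
  rewrite /M -natrM -natrD ler_nat /scale.
  have := root_scale_ge2 k; have := root_scale_gt k; rewrite !expnS expn0; nia.
have k0 k : 0 <= k%:R :> R by [].
pose theta : 'rV[R]_2 := \row_i nth 0 [:: lambda; 0] i.
pose v (a b : int) : 'rV[int]_2 := \row_i nth 0 [:: a; b] i.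
(* Here [z / mu0] = M^2/2 and [H / B] = M^2. The choice [mu0] = 1/(2M) is smaller than the square
   root of the available bound 1/(2M), which suffices and stays rational. *)
apply: (@sharp_of_shear R 1 200^-1 theta (fun k => (16 * M k)^-1)
  (fun k => M k ^+ 3) (fun k => M k / 4) M (fun k => (2 * M k)^-1)
  (fun k => [seq v (- (j%:Z * l k)) (j * scale k)%N%:Z
            | j : nat <- iota 0 (scale k ^ 2).+1])) => //.
- by rewrite mxE.
- move=> k; have := M8 k; set m := M k => m8; split.
  + by rewrite invr_gt0; lra.
  + by rewrite -div1r ler_pdivrMr; nra.
  + nra.
  + by field; lra.
- by move=> k; rewrite -natr1; have := kM k; have := M8 k; have := k0 k; nra.
- by move=> k; have := kM k; have := M8 k; have := k0 k; nra.
- by move=> k; have := kM k; have := M8 k; have := k0 k; split; nra.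
- move=> k; have := M8 k => m8; rewrite invr_gt0 invf_le1; lra.
- move=> k u u0; rewrite /M [(scale k)%:R]pmulrn ltr_int => uM.
  have [cop err] := H k; have m8 := M8 k.
  have m0 : 0 < (scale k)%:Z by have := scale_ge8 k; lia.
  have u1 : 1 <= `|u 0 ord_max|%:~R :> R by rewrite ler1z -gtz0_ge1 normr_gt0.
  have um : `|u 0 ord_max|%:~R <= M k by rewrite /M pmulrn ler_int ltW.
  have : 1 <= 2 * (scale k)%:Z%:~R * `|(u 0 ord0)%:~R + (u 0 ord_max)%:~R * lambda|.
    apply: (@dist_rational R (scale k) (l k)) => //.
      rewrite Gauss_dvdzl 1?coprimez_sym// dvdzE; apply/negP => /dvdn_leq.
      rewrite absz_gt0 => /(_ u0); lia.
    have d0 := normr_ge0 (M k * lambda - (l k)%:~R).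
    have := @approx_error_small R (M k) _ 1 m8 d0 _ isT.
    rewrite -pmulrn -/(M k) expr1 => /(_ ltac:(rewrite /M; lra)).
    set d := `|_ - _| in d0 *; set w := `|_|%:~R in um u1 *; nra.
  rewrite -pmulrn -/(M k) big_ord_recl big_ord1 !mxE/=.
  have -> : lift ord0 ord0 = ord_max :> 'I_2 by apply: val_inj.
  rewrite mulr0 addr0 normrM -intr_norm.
  set X := `|_|; set w := `|_|%:~R in um u1 *; set m := M k in m8 um *.
  move=> h; rewrite exprVn -div1r ler_pdivrMr; last by rewrite exprn_gt0//; lra.
  have : 1 * 1 <= (2 * m * X) * w by apply: ler_pM => //; lra.
  have := normr_ge0 ((u 0 ord0)%:~R + (u 0 ord_max)%:~R * lambda); rewrite -/X.
  nra.
- move=> k; rewrite map_inj_uniq ?iota_uniq// => i j /rowP/(_ ord_max).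
  rewrite !mxE /= => -[]/eqP; rewrite eqn_mul2r => /orP[|/eqP//].
  by have := scale_ge8 k; lia.
- move=> k _ /mapP[j + ->]; rewrite mem_iota => /= jm; split.
    rewrite mxE /= ger0_norm// -pmulrn natrM /M.
    rewrite [leRHS]exprSr ler_wpM2r// -natrX ler_nat; lia.
  move=> i im; have -> : i = ord0 by case: i im => -[|[|i]] //= hi _; exact: val_inj.
  rewrite !mxE/= rmorphN rmorphM/= -!pmulrn natrM -/(M k).
  have [_ err] := H k; have m8 := M8 k.
  have d0 := normr_ge0 (M k * lambda - (l k)%:~R).
  have := @approx_error_small R (M k) _ 3 m8 d0 _ isT.
  move=> /(_ ltac:(rewrite /M; lra)).
  have -> : - (j%:R * (l k)%:~R) + j%:R * M k * lambda =
    j%:R * (M k * lambda - (l k)%:~R) by ring.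
  have jM : j%:R <= M k ^+ 2 by rewrite /M -natrX ler_nat; lia.
  rewrite normrM normr_nat -div1r ler_pdivlMr; last lra.
  set d := `|_| in d0 *; set J := j%:R in jM *; set m := M k in m8 jM *.
  have : J * d <= m ^+ 2 * d by exact: ler_wpM2r.
  rewrite [m ^+ 3]exprSr; nra.
- move=> k; rewrite size_map size_iota -(addn1 (scale k ^ 2)) natrD natrX -/(M k).
  have := M8 k; set m := M k => m8.
  have -> : 200^-1 * (m / 4 / (2 * m)^-1 + m ^+ 3 / m) ^+ 1 + 2 ^+ 2 * (m / 4) ^+ 2
    = (1/2 + 1) / 200 * m ^+ 2 + m ^+ 2 / 4 by field; lra.
  nra.
Qed.

(** * Dimension three *)

Lemma sharp_dim3 (R : realType) : sharp_example 3 (200^-1 : R).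
Proof.
have [lambda [l Hl]] := exists_liouville R.
have [t1 [p Hp]] := exists_sqrt2_approx R.
(* This forces t1 + t2 = [lambda], the number approximated by l/m. *)
pose t2 := lambda - t1.
pose T k : R := (root_scale k)%:R.
pose M k : R := (scale k)%:R.
pose d1 k := M k * t1 - ((p k)%:~R + Num.sqrt 2).
pose d2 k := M k * t2 - ((l k - p k)%:~R - Num.sqrt 2).
have MT k : M k = T k ^+ 3 by rewrite /M /scale natrX.
have M8 k : 8 <= M k by rewrite /M ler_nat scale_ge8.
have T2 k : 2 <= T k by rewrite /T ler_nat root_scale_ge2.
have kT k : k%:R + 1 <= T k by rewrite /T natr1 ler_nat root_scale_gt.
have k0 k : 0 <= k%:R :> R by [].
have err1 k : M k ^+ 19 * `|d1 k| <= 8 by have := Hp k; rewrite -/(M k) -/(d1 k); lra.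
have err2 k : M k ^+ 19 * `|d2 k| <= 8.
  have -> : d2 k = (M k * lambda - (l k)%:~R) - d1 k.
    by rewrite /d2 /d1 /t2 rmorphB/=; ring.
  have := Hp k; have [_] := Hl k; rewrite -/(M k) -/(d1 k).
  have := ler_normB (M k * lambda - (l k)%:~R) (d1 k).
  set x := `|_|; set y := `|_|; set z := `|_| => xyz hy hz.
  have : M k ^+ 19 * x <= M k ^+ 19 * (y + z).
    by rewrite ler_wpM2l// exprn_ge0//; have := M8 k; lra.
  lra.
pose theta : 'rV[R]_3 := \row_i nth 0 [:: t1; t2; 0] i.
pose v (a b c : int) : 'rV[int]_3 := \row_i nth 0 [:: a; b; c] i.
(* The range |j| <= m^5 keeps |jm| below the height m^6; the tolerance 1/(80m) is slightly smaller
   than the half-width 1/(64m). *)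
have /choice[sk skP] : forall k, exists s : seq int,
    [/\ uniq s, ((scale k ^ 5).+1 <= 80 * scale k * size s)%N &
    forall j, j \in s -> `|j| <= (scale k ^ 5)%N%:Z /\
      exists a : int, (80 * scale k)%:R * `|a%:~R + j%:~R * Num.sqrt (2 : R)| <= 1].
  by move=> k; apply: dirichlet_count; have := scale_ge8 k; lia.
(* Choice needs a value for every pair; outside [sk] it is an arbitrary 0. *)
have /choice[a aP] : forall kj : nat * int, exists a : int, kj.2 \in sk kj.1 ->
    (80 * scale kj.1)%:R * `|a%:~R + kj.2%:~R * Num.sqrt (2 : R)| <= 1.
  move=> [k j]; have [_ _ H] := skP k.
  by have [/H[_ [a ah]]|_] := boolP (j \in sk k); [exists a|exists 0].
(* With M = T^3, [mu0] is the exact cube root of 1/(64 M^2), [z / mu0] = M^2/4 and [H / B] = M^2.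
   The listed vectors give points with first two coordinates y + j d1 and -y + j d2, where y = a + j
   sqrt 2. *)
apply: (@sharp_of_shear R 2 200^-1 theta (fun k => (64 * M k)^-1)
  (fun k => M k ^+ 6) (fun k => T k ^+ 4 / 16) (fun k => M k ^+ 4)
  (fun k => (4 * T k ^+ 2)^-1)
  (fun k => [seq v (a (k, j) - j * p k) (- a (k, j) + j * (p k - l k))
                   (j * scale k)
            | j : int <- sk k])) => //.
- by rewrite mxE.
- move=> k; rewrite MT; have := T2 k; set t := T k => t2'.
  have t3 : 2 ^+ 3 <= t ^+ 3 by rewrite lerXn2r ?nnegrE//; lra.
  have t4 : 2 ^+ 4 <= t ^+ 4 by rewrite lerXn2r ?nnegrE//; lra.
  have t46 : t ^+ 4 <= (t ^+ 3) ^+ 6 by rewrite -exprM ler_weXn2l//; lra.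
  split.
  + by rewrite invr_gt0; lra.
  + by rewrite -div1r ler_pdivrMr; nra.
  + lra.
  + by field; lra.
- move=> k; rewrite MT; have := T2 k; have := kT k; set t := T k => kt t2'.
  rewrite -natr1.
  have t5 : t ^+ 5 <= (t ^+ 3) ^+ 6 by rewrite -exprM ler_weXn2l//; lra.
  have t40 : 0 <= t ^+ 4 by rewrite exprn_ge0//; lra.
  rewrite exprS in t5; nra.
- move=> k; have := T2 k; have := kT k; have := k0 k; set t := T k => k0' kt t2'.
  have -> : 2 ^+ 3 * (t ^+ 4 / 16) ^+ 3 = t * (t / 2) ^+ 11 * 4 by field.
  have : 1 <= (t / 2) ^+ 11 by rewrite exprn_ege1//; lra.
  nra.
- move=> k; have := kT k; have := M8 k; rewrite MT; have := T2 k.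
  set t := T k => t2' m8 kt.
  have t1' : t ^+ 1 <= (t ^+ 3) ^+ 4 by rewrite -exprM ler_weXn2l//; lra.
  split; [by rewrite exprn_gt0//; lra| |lra].
  by rewrite ler_weXn2l//; lra.
- move=> k; have := T2 k => t2'; rewrite invr_gt0 invf_le1; nra.
- move=> k u u0; rewrite /M [(scale k)%:R]pmulrn -rmorphXn/= ltr_int => uM.
  have [cop _] := Hl k.
  have m0 : 0 < (scale k)%:Z by have := scale_ge8 k; lia.
  have := @norm_form_lower_bound R _ _ (p k) (u 0 ord0) (u 0 (lift ord0 ord0))
    _ t1 t2 m0 cop u0 (ltW uM).
  rewrite -pmulrn -/(M k) -/(d1 k) -/(d2 k).
  have h1 := @approx_error_small R _ _ 8 (M8 k) (normr_ge0 _) (err1 k) isT.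
  have h2 := @approx_error_small R _ _ 8 (M8 k) (normr_ge0 _) (err2 k) isT.
  have M80 : 0 <= M k ^+ 8 by rewrite exprn_ge0//; have := M8 k; lra.
  have e1 : 0 <= M k ^+ 8 * `|d1 k| by rewrite mulr_ge0.
  have e2 : 0 <= M k ^+ 8 * `|d2 k| by rewrite mulr_ge0.
  move=> /(_ ltac:(lra) ltac:(lra)).
  rewrite !big_ord_recl big_ord0 !mxE/=.
  have -> : lift ord0 (lift ord0 ord0) = ord_max :> 'I_3 by apply: val_inj.
  rewrite mulr0 addr0 mulr1 !normrM -intr_norm mulrA.
  set X := _ * _ * `|_|%:~R => h; rewrite exprVn -div1r ler_pdivrMr.
    by rewrite MT in h; rewrite [leRHS](_ : _ = 64 * (T k ^+ 3) ^+ 2 * X)//; ring.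
  by rewrite exprn_gt0// mulr_gt0// exprn_gt0//; have := T2 k; lra.
- move=> k; have [us _ _] := skP k; rewrite map_inj_uniq// => i j /rowP/(_ ord_max).
  by rewrite !mxE /= => /mulIf; apply; have := scale_ge8 k; lia.
- move=> k _ /mapP[j jk ->]; have [_ _ /(_ _ jk)[jm _]] := skP k.
  have := aP (k, j) jk; rewrite [_.1]/= [_.2]/= natrM -/(M k).
  set x := a (k, j); set y := _ + _ * Num.sqrt 2 => hy.
  have jM : `|j|%:~R <= M k ^+ 5.
    by rewrite /M pmulrn -rmorphXn ler_int; apply: le_trans jm _;
      rewrite -natrXE rmorphXn.
  have m8 := M8 k.
  (* The approximation error must fit into the slack 1/(64M) - 1/(80M) = 1/(320M). *)
  have small d : 0 <= d -> M k ^+ 19 * d <= 8 ->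
      `|j|%:~R * d + (80 * M k)^-1 <= (64 * M k)^-1.
    move=> d0 md; have := @approx_error_small R _ _ 6 m8 d0 md isT.
    have : `|j|%:~R * d <= M k ^+ 5 * d by exact: ler_wpM2r.
    rewrite [M k ^+ 6]exprS -mulrA; set f := _ ^+ 5 * d.
    set e := `|j|%:~R * d => ef mf.
    rewrite -lerBrDr; have -> : (64 * M k)^-1 - (80 * M k)^-1 = 1 / (320 * M k).
      by field; exact: lt0r_neq0 (lt_le_trans _ m8).
    rewrite ler_pdivlMr; last lra.
    have : e * M k <= f * M k by apply: ler_wpM2r => //; lra.
    lra.
  have hy' : `|y| <= (80 * M k)^-1 by rewrite -div1r ler_pdivlMr 1?mulrC//; lra.
  split.
    rewrite mxE/= normrM [X in _ * X]ger0_norm// rmorphM/= -pmulrn -/(M k).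
    by rewrite [leRHS]exprSr ler_wpM2r//; lra.
  move=> i im; rewrite !mxE.
  have : i = ord0 \/ i = lift ord0 ord0.
    by case: i im => -[|[|[|i]]] //= hi _; [left|right]; exact: val_inj.
  case=> -> /=.
    have -> : (x - j * p k)%:~R + (j * scale k)%:~R * t1 = y + j%:~R * d1 k.
      by rewrite /y /d1 /M rmorphB !rmorphM/= -!pmulrn; ring.
    apply: le_trans (ler_normD _ _) _; rewrite normrM -intr_norm addrC.
    by apply: le_trans (small _ (normr_ge0 _) (err1 k)); rewrite lerD2l.
  have -> : (- x + j * (p k - l k))%:~R + (j * scale k)%:~R * t2 = j%:~R * d2 k - y.
    by rewrite /y /d2 /M rmorphD rmorphN !rmorphM/= !rmorphB/= -!pmulrn; ring.
  apply: le_trans (ler_normB _ _) _; rewrite normrM -intr_norm.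
  by apply: le_trans (small _ (normr_ge0 _) (err2 k)); rewrite lerD2l.
- move=> k; rewrite size_map; have [_ sz _] := skP k; move: sz.
  rewrite -(ler_nat R) -(addn1 (scale k ^ 5)) natrD natrX (natrM _ (80 * _)).
  rewrite (natrM _ 80) -/(M k).
  set S := (size _)%:R; have -> : 200^-1 * (T k ^+ 4 / 16 / (4 * T k ^+ 2)^-1 +
    M k ^+ 6 / M k ^+ 4) ^+ 2 + 2 ^+ 3 * (T k ^+ 4 / 16) ^+ 3
    = ((5 / 4) ^+ 2 / 200 + 1 / 512) * M k ^+ 4.
    by rewrite MT; field; exact: lt0r_neq0 (lt_le_trans _ (T2 k)).
  have := M8 k; set m := M k => m8.
  have m4 : 0 <= m ^+ 4 by rewrite exprn_ge0//; lra.
  (* Hence S >= m^4/80, and (5/4)^2/200 + 1/512 = 5/512 is below 1/80. *)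
  rewrite [m ^+ 5]exprS => h; have : m * m ^+ 4 <= m * (80 * S) by lra.
  rewrite ler_pM2l; lra.
Qed.

Theorem theorem2p2 (R : realType) :
  exists2 cabs : R, 0 < cabs &
  forall n : nat, n = 2%N \/ n = 3%N ->
  exists (L : set 'rV[R]_n) (Q : nat -> 'rV[R]_n),
    [/\ is_lattice L, lattice_det L = 1
      & weakly_admissible (@last_coord0 R n) L] /\
    [/\ forall k (i : 'I_n), 0 < Q k 0 i,
        forall k (i : 'I_n), (i.+1 < n)%N -> Q k 0 i <= Qbar (Q k),
        Qbar (Q k) / Qmax (Q k) @[k --> \oo] --> (0 : R),
        box_vol (Q k) @[k --> \oo] --> +oo
      & forall k : nat,
        (cabs%:E *
           ereal_inf [set ((Qbar (Q k))%:E / mu (@last_coord0 R n) L B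
                           + (Qmax (Q k) / B)%:E) ^+ n.-1
                     | B in [set B : R | (0 < B <= Qmax (Q k))%R]]
         <= (`|(box_count L (Q k))%:R - box_vol (Q k) / lattice_det L|%R)%:E)%E].
Proof.
exists 200^-1 => [|n [->|->]]; first by rewrite invr_gt0.
- exact: sharp_dim2.
- exact: sharp_dim3.
Qed.
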